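(* Let $n \geq 3$ and let $F$ be a strongly independent set of vertices in the hypercube $Q_n$. Then $Q_n - F$ is $(n-1)$-connected.
   Context: The hypercube $Q_n$ has vertex set $\{0,1\}^n$, two vertices being adjacent iff they differ in exactly one coordinate. For $F \subseteq V(Q_n)$, $Q_n - F$ is the subgraph induced on $V(Q_n)\setminus F$. A set $F \subseteq V(Q_n)$ is strongly independent (or distant) if $N[u] \cap N[v] = \emptyset$ for every two distinct $u, v \in F$, where $N[u]$ is the closed neighbourhood of $u$; equivalently, any two distinct vertices of $F$ are at distance at least $3$. A graph is $r$-connected if it has more than $r$ vertices and remains connected after deleting any set of fewer than $r$ vertices. *)

(* Defs.v *)
From mathcomp Require Import all_boot.

Set Implicit Arguments.
Unset Strict Implicit.
Unset Printing Implicit Defensive.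

Definition cube (n : nat) : finType := {ffun 'I_n -> bool}.

Definition cube_adj (n : nat) : rel (cube n) :=
  fun u v => #|[set i : 'I_n | u i != v i]| == 1.

Definition closed_nbhd (T : finType) (e : rel T) (u : T) : {set T} :=
  [set v | (v == u) || e u v].

Definition strongly_independent (T : finType) (e : rel T) (F : {set T}) : Prop :=
  {in F &, forall u v, u != v -> [disjoint closed_nbhd e u & closed_nbhd e v]}.

(* A graph is an adjacency relation [e] (symmetric and irreflexive in the
   intended uses) together with a vertex set [S]: it is the subgraph of
   [(T, e)] induced on [S]. *)
Definition induced_adj (T : finType) (e : rel T) (S : {set T}) : rel T :=
  fun u v => [&& u \in S, v \in S & e u v].

Definition graph_connected (T : finType) (e : rel T) (S : {set T}) : Prop :=
  S != set0 /\ {in S &, forall u v, connect (induced_adj e S) u v}.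

Definition r_connected (r : nat) (T : finType) (e : rel T) (S : {set T}) : Prop :=
  r < #|S| /\
  forall X : {set T}, X \subset S -> #|X| < r -> graph_connected e (S :\: X).

(* Main.v *)
Require Import Defs.
From mathcomp Require Import all_boot.
From mathcomp Require Import zify.

(** The connectivity is proved for subcubes, by induction on the number k of
    free coordinates: if X meets a subcube in at most k - 2 vertices, any two of
    its vertices outside F and X are joined in Q_n - F - X.  Since u has more
    neighbours in the subcube than X has vertices there, some direction i has
    u^i outside X; split the subcube along i.  A vertex w outside F and X with
    w^i outside X can always cross to the other half: directly if w^i is not in
    F, and otherwise along w, w^j, (w^j)^i for some j, because neither w^j nor
    (w^j)^i can be in F together with w^i, and X is too small to meet all these
    pairs.  If both halves satisfy the induction hypothesis, one crossing from u
    suffices; if not, all of X lies in one half and every vertex of that half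
    can cross to the other one. *)

(** * Coordinate flips and subcubes *)

Definition flip {n : nat} (i : 'I_n) (u : cube n) : cube n :=
  [ffun j => u j (+) (j == i)].

(** [I] holds the free coordinates; [u] only fixes the others, so any vertex of the subcube can
    replace it. *)
Definition subcube {n : nat} (I : {set 'I_n}) (u : cube n) : {set cube n} :=
  [set v : cube n | [forall i, (i \notin I) ==> (v i == u i)]].

Lemma flipE (n : nat) (i : 'I_n) (u : cube n) (j : 'I_n) :
  flip i u j = u j (+) (j == i).
Proof. by rewrite ffunE. Qed.

Lemma flip_adj (n : nat) (i : 'I_n) (u : cube n) : cube_adj u (flip i u).
Proof.
rewrite /cube_adj -(cards1 i); apply/eqP; congr #|pred_of_set _|; apply/setP=> j.
by rewrite !inE flipE; case: (u j); case: (j == i).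
Qed.

Lemma flip_inj (n : nat) (u : cube n) : injective (fun i => flip i u).
Proof.
move=> i j /(congr1 (fun w : cube n => w i)) /=.
by rewrite !flipE eqxx; case: (u i); case: eqP.
Qed.

Lemma flip_neq (n : nat) (i : 'I_n) (u : cube n) : flip i u != u.
Proof.
by apply/eqP=> /(congr1 (fun w : cube n => w i)); rewrite flipE eqxx; case: (u i).
Qed.

Lemma flipC (n : nat) (i j : 'I_n) (u : cube n) :
  flip i (flip j u) = flip j (flip i u).
Proof. by apply/ffunP=> k; rewrite !flipE addbAC. Qed.

Lemma cube_adj_sym (n : nat) : symmetric (@cube_adj n).
Proof.
move=> u v; rewrite /cube_adj; congr (#|pred_of_set _| == 1).
by apply/setP=> i; rewrite !inE eq_sym.
Qed.

Lemma subcubeP (n : nat) (I : {set 'I_n}) (u v : cube n) :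
  reflect (forall i, i \notin I -> v i = u i) (v \in subcube I u).
Proof.
rewrite inE; apply: (iffP forallP) => h i; first by move/(implyP (h i))/eqP.
by apply/implyP=> /h ->.
Qed.

Lemma flip_subcube (n : nat) (I : {set 'I_n}) (i : 'I_n) (u v : cube n) :
  i \in I -> v \in subcube I u -> flip i v \in subcube I u.
Proof.
move=> iI /subcubeP h; apply/subcubeP=> j jI; rewrite flipE h //.
by case: eqP jI => [->|]; rewrite ?iI ?addbF.
Qed.

Lemma subcube_eq (n : nat) (I : {set 'I_n}) (u v : cube n) :
  v \in subcube I u -> subcube I v = subcube I u.
Proof.
move=> /subcubeP h; apply/setP=> w.
by apply/subcubeP/subcubeP => hw i iI; rewrite hw // h.
Qed.

Lemma subcubeD1 (n : nat) (I : {set 'I_n}) (i : 'I_n) (u v : cube n) :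
  v \in subcube I u -> v i = u i -> v \in subcube (I :\ i) u.
Proof.
move=> /subcubeP h e; apply/subcubeP=> j; rewrite !inE negb_and negbK.
by case/orP=> [/eqP -> //|]; apply: h.
Qed.

Lemma subcube_halves_leq (n : nat) (I : {set 'I_n}) (i : 'I_n) (u v : cube n)
    (X : {set cube n}) : v \in subcube I u -> v i != u i -> i \in I ->
  #|X :&: subcube (I :\ i) u| + #|X :&: subcube (I :\ i) v|
    <= #|X :&: subcube I u|.
Proof.
move=> vI vi iI.
have sub (w : cube n) : subcube (I :\ i) w \subset subcube I w.
  apply/subsetP=> x /subcubeP h; apply/subcubeP=> j jI; apply: h.
  by rewrite !inE negb_and jI orbT.
have dis : (X :&: subcube (I :\ i) u) :&: (X :&: subcube (I :\ i) v) = set0.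
  apply/setP=> x; rewrite in_set0; apply/negP.
  rewrite 2!in_setI => /andP [/andP [_ /subcubeP hu]].
  rewrite in_setI => /andP [_ /subcubeP hv].
  by move: vi; rewrite -hu -?hv ?eqxx // !inE eqxx.
rewrite -cardsUI dis cards0 addn0; apply: subset_leq_card.
by rewrite subUset !setIS ?sub // -(subcube_eq _ _ _ _ vI) sub.
Qed.

(** * Directions avoiding [X], by pigeonhole *)

Lemma exists_not_image (T J : finType) (X : {set T}) (A : {set J}) (h : T -> J) :
  #|X| < #|A| -> exists2 j, j \in A & forall x, x \in X -> h x != j.
Proof.
move=> XA; have /subsetPn [j jA jX] : ~~ (A \subset h @: X).
  apply: contraL XA => /subset_leq_card AX.
  by rewrite -leqNgt (leq_trans AX) // leq_imset_card.
by exists j => // x xX; apply: contraNneq jX => <-; apply: imset_f.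
Qed.

Lemma flip_avoid (n : nat) (I : {set 'I_n}) (u : cube n) (X : {set cube n}) :
  #|X :&: subcube I u| < #|I| -> exists2 i, i \in I & flip i u \notin X.
Proof.
case: (set_0Vmem I) => [->|[i0 _]]; first by rewrite cards0.
(* Each vertex of [X] is charged to one direction, and [flip i u] can only be charged to [i]; the
   default [i0] serves [x = u]. *)
pose h (x : cube n) := odflt i0 [pick j | x j != u j].
case/(exists_not_image _ _ _ _ h) => i iI hi; exists i => //.
apply/negP=> iX; have /hi/negP[] : flip i u \in X :&: subcube I u.
  by rewrite in_setI iX flip_subcube //; apply/subcubeP.
rewrite /h; case: pickP => [j|/(_ i)] /=; rewrite flipE.
  by case: (j == i) => //; rewrite addbF eqxx.
by rewrite eqxx; case: (u i).
Qed.

(** For distinct [j] the pairs [flip j u], [flip i (flip j u)] are disjoint, so a vertex of [X]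
    spoils at most one [j]; [h] finds it by ignoring coordinate [i]. *)
Lemma flip_pair_avoid (n : nat) (I : {set 'I_n}) (i : 'I_n) (u : cube n)
    (X : {set cube n}) : i \in I -> #|X :&: subcube I u| < #|I :\ i| ->
  exists2 j, j \in I :\ i & (flip j u \notin X) && (flip i (flip j u) \notin X).
Proof.
move=> iI; pose h (x : cube n) := odflt i [pick j | (j != i) && (x j != u j)].
case/(exists_not_image _ _ _ _ h) => j; rewrite in_setD1 => /andP [ji jI] hj.
exists j; first by rewrite in_setD1 ji.
have uI : u \in subcube I u by apply/subcubeP.
have hE (x : cube n) : x \in subcube I u ->
    (forall k, k != i -> x k = flip j u k) -> x \notin X.
  move=> xI e; apply/negP=> xX; have /hj/negP[] : x \in X :&: subcube I u by rewrite in_setI xX.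
  rewrite /h; case: pickP => [k /andP [ki]|/(_ j)] /=.
    by rewrite e // flipE; case: (k == j) => //; rewrite addbF eqxx.
  by rewrite ji e // flipE eqxx; case: (u j).
rewrite !hE ?flip_subcube // => k ki.
by rewrite flipE (negbTE ki) addbF.
Qed.

(** * Strong independence and flips *)

Lemma strongly_independent_eq (T : finType) (e : rel T) (F : {set T}) (x y z : T) :
  strongly_independent e F -> x \in F -> y \in F ->
  z \in closed_nbhd e x -> z \in closed_nbhd e y -> x = y.
Proof.
move=> hF xF yF zx zy; apply/eqP/negP=> /negP xy.
by have /disjointFr/(_ zx) := hF x y xF yF xy; rewrite zy.
Qed.

(** Otherwise [u] would lie in the closed neighbourhoods of two distinct members of [F], itself and
    its flip. *)
Lemma strongly_independent_flip (n : nat) (F : {set cube n}) (u : cube n) (i : 'I_n) :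
  strongly_independent (@cube_adj n) F -> u \in F -> flip i u \notin F.
Proof.
move=> hF uF; apply/negP=> vF; have /negP[] := flip_neq n i u; apply/eqP.
apply: (strongly_independent_eq _ _ _ _ _ u hF) => //; rewrite inE ?eqxx //.
by rewrite cube_adj_sym flip_adj orbT.
Qed.

Lemma strongly_independent_flip2 (n : nat) (F : {set cube n}) (u : cube n)
    (i j : 'I_n) : strongly_independent (@cube_adj n) F ->
  i != j -> flip i u \in F -> flip j u \notin F.
Proof.
move=> hF ij uF; apply/negP=> vF; have /negP[] := ij; apply/eqP.
apply: (flip_inj _ u); apply: (strongly_independent_eq _ _ _ _ _ u hF) => //.
  by rewrite inE cube_adj_sym flip_adj orbT.
by rewrite inE cube_adj_sym flip_adj orbT.
Qed.

(** * Paths avoiding [F] and [X] *)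

Lemma connect_flip (n : nat) (S : {set cube n}) (i : 'I_n) (u : cube n) :
  u \in S -> flip i u \in S -> connect (induced_adj (@cube_adj n) S) u (flip i u).
Proof. by move=> uS vS; apply: connect1; rewrite /induced_adj uS vS flip_adj. Qed.

Lemma connect_cross (n : nat) (F X : {set cube n}) (I : {set 'I_n}) (i : 'I_n)
    (u : cube n) : strongly_independent (@cube_adj n) F ->
  i \in I -> #|X :&: subcube I u| < #|I :\ i| ->
  u \in ~: F :\: X -> flip i u \notin X ->
  exists v, [/\ v \in ~: F :\: X, v \in subcube I u, v i != u i
    & connect (induced_adj (@cube_adj n) (~: F :\: X)) u v].
Proof.
move=> hF iI cX uS uiX; have uI : u \in subcube I u by apply/subcubeP.
case: (boolP (flip i u \in F)) => uiF; last first.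
  have vS : flip i u \in ~: F :\: X by rewrite in_setD in_setC uiX.
  exists (flip i u); split=> //; [exact: flip_subcube| |exact: connect_flip].
  by rewrite flipE eqxx; case: (u i).
have [j] := flip_pair_avoid _ _ _ _ _ iI cX.
rewrite in_setD1 => /andP [ji jI] /andP [ujX uijX].
have ujS : flip j u \in ~: F :\: X.
  by rewrite in_setD in_setC ujX (strongly_independent_flip2 _ _ _ i) // eq_sym.
(* Once the flips are commuted, this is a neighbour of [flip i u], which is in [F]. *)
have uijS : flip i (flip j u) \in ~: F :\: X.
  by rewrite in_setD in_setC uijX flipC strongly_independent_flip.
exists (flip i (flip j u)); split=> //; first by rewrite !flip_subcube.
  by rewrite !flipE eqxx [i == j]eq_sym (negbTE ji); case: (u i).
by apply: (@connect_trans _ _ (flip j u)); apply: connect_flip.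
Qed.

Lemma induced_connect_sym (n : nat) (S : {set cube n}) :
  connect_sym (induced_adj (@cube_adj n) S).
Proof.
apply: sym_connect_sym => u v; rewrite /induced_adj cube_adj_sym.
by rewrite andbCA.
Qed.

Lemma subcube_connect (n : nat) (F X : {set cube n}) (I : {set 'I_n}) (u v : cube n) :
  strongly_independent (@cube_adj n) F ->
  #|X :&: subcube I u| <= #|I| - 2 -> v \in subcube I u ->
  u \in ~: F :\: X -> v \in ~: F :\: X ->
  connect (induced_adj (@cube_adj n) (~: F :\: X)) u v.
Proof.
move=> hF; move: {2}#|I| (leqnn #|I|) => k.
elim: k I u v => [|k IH] I u v Ik cX vI uS vS.
  suff -> : u = v by [].
  apply/ffunP=> i; apply/esym/(elimT (subcubeP _ _ _ _) vI).
  by move: Ik; rewrite leqn0 cards_eq0 => /eqP ->; rewrite inE.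
(* Crossing needs fewer than [#|I| - 1] vertices of [X], which the truncated bound [#|I| - 2] gives
   only for [#|I| >= 2]. Below that, [u] and [v] are equal or adjacent. *)
case: (leqP #|I| 1) => I1.
  case: (altP (u =P v)) => [-> //|uv]; apply: connect1.
  rewrite /induced_adj uS vS /=; move/subcubeP: vI => vI.
  rewrite /cube_adj eqn_leq card_gt0; apply/andP; split.
    apply: leq_trans I1; apply/subset_leq_card/subsetP=> i; rewrite inE.
    by apply: contraNT => /vI ->.
  apply: contra uv => /eqP e; apply/eqP/ffunP=> i; apply/eqP/negPn.
  by have := in_set0 i; rewrite -e inE => ->.
have [i iI uiX] : exists2 i, i \in I & flip i u \notin X by apply: flip_avoid; lia.
have I' : #|I| = #|I :\ i|.+1 by rewrite (cardsD1 i) iI.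
rewrite I' in Ik cX I1.
have IH' x y : x \in subcube I u -> y \in subcube I u -> y i = x i ->
    #|X :&: subcube (I :\ i) x| <= #|I :\ i| - 2 ->
    x \in ~: F :\: X -> y \in ~: F :\: X ->
    connect (induced_adj (@cube_adj n) (~: F :\: X)) x y.
  move=> xI yI e cx; apply: (IH (I :\ i)) => //.
  by apply: subcubeD1 => //; rewrite (subcube_eq _ _ _ _ xI).
(* A half with more than [#|I :\ i| - 2] vertices of [X] already exhausts the bound for the whole
   subcube. *)
have halves x y : x \in subcube I u -> y \in subcube I u -> y i != x i ->
    #|X :&: subcube (I :\ i) x| <= #|I :\ i| - 2 \/
    X :&: subcube (I :\ i) y = set0.
  move=> xI yI yx; have xE := subcube_eq _ _ _ _ xI.
  have := subcube_halves_leq _ I i x y X; rewrite xE => /(_ yI yx iI) h.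
  case: (leqP #|X :&: subcube (I :\ i) x| (#|I :\ i| - 2)) => c; [by left|right].
  apply/eqP; rewrite -cards_eq0 -leqn0; move: (leq_trans h cX) c.
  by move: #|X :&: _| #|X :&: _| #|I :\ i| => a b c; lia.
have cross x : x \in subcube I u -> x \in ~: F :\: X -> flip i x \notin X ->
    exists y, [/\ y \in ~: F :\: X, y \in subcube I u, y i != x i
      & connect (induced_adj (@cube_adj n) (~: F :\: X)) x y].
  move=> xI xS xX; have xE := subcube_eq _ _ _ _ xI.
  by rewrite -xE; apply: connect_cross => //; rewrite xE; apply: leq_ltn_trans cX _;
    move: I1; case: #|I :\ i| => // a _; lia.
have far x y : x \in subcube I u -> y \in subcube I u -> y i != x i ->
    X :&: subcube (I :\ i) y = set0 -> flip i x \notin X.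
  move=> xI yI yx e; apply/negP=> xX; have := in_set0 (flip i x).
  rewrite -e in_setI xX subcubeD1 //.
    by rewrite flip_subcube // (subcube_eq _ _ _ _ yI).
  by move: yx; rewrite flipE eqxx; case: (x i); case: (y i).
have uI : u \in subcube I u by apply/subcubeP.
have [u' [u'S u'I u'i cu]] := cross u uI uS uiX.
have symc := induced_connect_sym n (~: F :\: X).
case: (altP (v i =P u i)) => vi.
  (* If the common half of [u] and [v] is too full, both cross, and their images are joined in the
     half free of [X]. *)
  case: (halves u u' uI u'I u'i) => [c|e]; first exact: IH'.
  have [|v' [v'S v'I v'i cv]] := cross v vI vS.
    by apply: (far v u') => //; rewrite vi.
  apply: connect_trans cu _; rewrite symc; apply: connect_trans cv _.
  rewrite symc; apply: IH' => //; last by rewrite e cards0.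
  by move: v'i u'i; rewrite vi; case: (v' i); case: (u' i); case: (u i).
have vu' : v i = u' i by move: vi u'i; case: (v i); case: (u' i); case: (u i).
(* Now [u'] is in the half of [v]. If that half is too full, the half of [u] is free of [X], and [v]
   crosses into it instead. *)
case: (halves u' u u'I uI); first by rewrite eq_sym.
  by move=> c; apply: connect_trans cu _; apply: IH'.
move=> e; have [|v' [v'S v'I v'i cv]] := cross v vI vS.
  by apply: (far v u) => //; rewrite eq_sym.
rewrite symc; apply: connect_trans cv _; rewrite symc; apply: IH' => //.
  by move: v'i vi; case: (v' i); case: (v i); case: (u i).
by rewrite e cards0.
Qed.

(** * Counting vertices and conclusion *)

Lemma strongly_independent_card_setC (n : nat) (F : {set cube n}) :
  strongly_independent (@cube_adj n) F -> n <= #|~: F|.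
Proof.
(* The [n] distinct neighbours of a vertex of [F] avoid [F]; if [F] is empty, any vertex serves. *)
move=> hF; have [f hf] : exists f, forall i, flip i f \notin F.
  case: (set_0Vmem F) => [->|[f fF]]; last first.
    by exists f => i; apply: strongly_independent_flip.
  by exists [ffun=> false] => i; rewrite inE.
rewrite -[leqLHS]card_ord -(card_imset _ (flip_inj n f)).
by apply/subset_leq_card/subsetP=> _ /imsetP [i _ ->]; rewrite in_setC.
Qed.

Theorem theorem5p1 (n : nat) (hn : 3 <= n) (F : {set cube n})
    (hF : strongly_independent (@cube_adj n) F) :
  r_connected (n - 1) (@cube_adj n) (~: F).
Proof.
have cF := strongly_independent_card_setC n F hF.
split=> [|X XF cX]; first lia.
split=> [|u v uS vS].
  by rewrite -card_gt0 cardsD (setIidPr XF); lia.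
(* With all coordinates free the subcube is the whole cube, and [#|X| < n - 1] is the required bound
   [n - 2]. *)
apply: (subcube_connect n F X [set: 'I_n]) => //.
  rewrite cardsT card_ord; have := subset_leq_card (subsetIl X (subcube setT u)).
  lia.
by apply/subcubeP=> i; rewrite inE.
Qed.
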